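(* For every graph $G$ with average degree $d(G)$, $$\mathrm{pw}(L(G)) \geq \mathrm{tw}(L(G)) > \tfrac{1}{8}d(G)^2 + \tfrac{3}{4}d(G) - 2.$$
   Context: Graphs are finite, simple and undirected, and $G$ has at least one vertex. The average degree is $d(G)=2|E(G)|/|V(G)|$. The line graph $L(G)$ has vertex set $E(G)$, two distinct elements being adjacent if and only if the corresponding edges of $G$ share an endpoint. A tree decomposition of a graph $H$ is a (nonempty) tree $T$ together with a collection of subsets of $V(H)$ (bags) indexed by the nodes of $T$ such that: every vertex of $H$ is in at least one bag; for each vertex $v$ of $H$, the nodes whose bags contain $v$ induce a connected subtree of $T$; and for each edge of $H$ some bag contains both its endpoints. Its width is the size of the largest bag minus 1. The treewidth $\mathrm{tw}(H)$ is the minimum width of a tree decomposition of $H$; the pathwidth $\mathrm{pw}(H)$ is the minimum width over tree decompositions whose tree $T$ is a path. (If $H$ has no vertices, $\mathrm{tw}(H)=\mathrm{pw}(H)=-1$.) *)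

(* Defs.v *)
From mathcomp Require Import all_boot all_order all_algebra.
From mathcomp Require Import boolp.

Set Implicit Arguments.
Unset Strict Implicit.
Unset Printing Implicit Defensive.

Import Order.TTheory GRing.Theory Num.Theory.

Record sgraph := SGraph {
  vertex :> finType;
  adj : rel vertex;
  adj_sym : symmetric adj;
  adj_irrefl : irreflexive adj }.

Definition edges (G : sgraph) : {set {set G}} :=
  [set [set p.1; p.2] | p : G * G & adj p.1 p.2].

Definition avg_degree (G : sgraph) : rat :=
  (2 * #|edges G|%:R / #|G|%:R)%R.

Section LineGraph.
Variable G : sgraph.

Definition line_vertex : finType := {e : {set G} | e \in edges G}.

Definition line_adj : rel line_vertex :=
  [rel e f | (e != f) && (val e :&: val f != set0)].

Lemma line_adj_sym : symmetric line_adj.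
Proof. by move=> e f; rewrite /line_adj /= eq_sym setIC. Qed.

Lemma line_adj_irrefl : irreflexive line_adj.
Proof. by move=> e; rewrite /line_adj /= eqxx. Qed.

Definition line_graph : sgraph := SGraph line_adj_sym line_adj_irrefl.
End LineGraph.

Definition connected_on (G : sgraph) (A : {set G}) : Prop :=
  {in A &, forall x y, connect [rel u v in A | adj u v] x y}.

Definition acyclic (G : sgraph) : Prop :=
  forall s : seq G, ucycle (@adj G) s -> size s <= 2.

Definition is_tree (T : sgraph) : Prop :=
  [/\ 0 < #|T|, connected_on [set: T] & acyclic T].

Definition is_path (T : sgraph) : Prop :=
  exists s : seq T,
    [/\ uniq s, forall x, x \in s
      & forall x y, adj x y = (index y s == (index x s).+1)
                           || (index x s == (index y s).+1)].

Record tree_dec (H : sgraph) := TreeDec {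
  td_tree : sgraph;
  td_bag : td_tree -> {set H};
  td_treeP : is_tree td_tree;
  td_vertexP : forall v : H, exists t, v \in td_bag t;
  td_connP : forall v : H, connected_on [set t | v \in td_bag t];
  td_edgeP : forall u v : H, adj u v ->
    exists t, (u \in td_bag t) && (v \in td_bag t) }.

Definition max_bag (H : sgraph) (D : tree_dec H) : nat :=
  \max_(t : td_tree D) #|td_bag t|.

Definition width (H : sgraph) (D : tree_dec H) : int :=
  ((max_bag D)%:Z - 1)%R.

Section TrivialDecomposition.
Variable H : sgraph.

Fact unit_adj_sym : symmetric (fun _ _ : unit => false).
Proof. by []. Qed.

Fact unit_adj_irrefl : irreflexive (fun _ _ : unit => false).
Proof. by []. Qed.

Definition unit_graph : sgraph := SGraph unit_adj_sym unit_adj_irrefl.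

Lemma unit_connected_on (A : {set unit_graph}) : connected_on A.
Proof. by move=> [] [] _ _; exact: connect0. Qed.

Lemma unit_is_tree : is_tree unit_graph.
Proof.
split; first by rewrite card_unit.
  exact: unit_connected_on.
by move=> [|[] [|[] s]].
Qed.

Lemma unit_is_path : is_path unit_graph.
Proof. by exists [:: tt]; split=> // [[]|[] []]. Qed.

Definition trivial_dec : tree_dec H.
Proof.
apply: (@TreeDec H unit_graph (fun=> [set: H]) unit_is_tree).
- by move=> v; exists tt; rewrite inE.
- by move=> v; exact: unit_connected_on.
- by move=> u v _; exists tt; rewrite !inE.
Defined.
End TrivialDecomposition.

Section Widths.
Variable H : sgraph.

Lemma tree_dec_ex :
  exists k, `[< exists D : tree_dec H, max_bag D = k >].
Proof. by exists (max_bag (trivial_dec H)); apply/asboolP; exists (trivial_dec H). Qed.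

Lemma path_dec_ex :
  exists k, `[< exists2 D : tree_dec H, is_path (td_tree D) & max_bag D = k >].
Proof.
exists (max_bag (trivial_dec H)); apply/asboolP.
by exists (trivial_dec H) => //; exact: unit_is_path.
Qed.

(* The minimum is taken over the largest bag size, a natural number, and
   shifted by 1 in int: the graph without vertices has width -1. *)
Definition treewidth : int := ((ex_minn tree_dec_ex)%:Z - 1)%R.
Definition pathwidth : int := ((ex_minn path_dec_ex)%:Z - 1)%R.

Lemma treewidthP :
  (exists D : tree_dec H, width D = treewidth) /\
  (forall D : tree_dec H, (treewidth <= width D)%R).
Proof.
rewrite /treewidth /width; case: ex_minnP => k /asboolP[D0 <-] kmin.
split=> [|D]; first by exists D0.
by rewrite lerD2r lez_nat; apply: kmin; apply/asboolP; exists D.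
Qed.

Lemma pathwidthP :
  (exists2 D : tree_dec H, is_path (td_tree D) & width D = pathwidth) /\
  (forall D : tree_dec H, is_path (td_tree D) -> (pathwidth <= width D)%R).
Proof.
rewrite /pathwidth /width; case: ex_minnP => k /asboolP[D0 D0p <-] kmin.
split=> [|D Dp]; first by exists D0.
by rewrite lerD2r lez_nat; apply: kmin; apply/asboolP; exists D.
Qed.
End Widths.

(* Main.v *)
(** Let k = |E(G)| / |V(G)| be half the average degree.  A nonempty vertex set W
    maximising e(W) - k |W| satisfies: every S in W meets at least k |S| edges
    of G[W].  The edges at a vertex v form a clique of L(G), so some node f(v)
    of the tree T of a given decomposition has a bag containing all of them; an
    edge vw then lies in the bag of every node t that equals f(v) or separates
    f(v) from f(w).  With m = ceil(k), choose a branch of T holding more than m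
    vertices of W and minimal with that property; the node t through which it
    is attached sees more than m vertices there, grouped into the components of
    the branch minus t, each holding at most m.  The bag of t contains every
    edge meeting these vertices except those inside one component, hence at
    least the sum of k c - c (c - 1) / 2 over the component sizes c, vertices
    placed at t counting as components of size 1.  By concavity the worst case
    is sizes m and 1, which gives k^2 / 2 + 3 k / 2 = d^2 / 8 + 3 d / 4. *)
Require Import Defs.
From mathcomp Require Import all_boot all_order all_algebra.
From mathcomp Require Import boolp.
From mathcomp Require Import ring lra zify.

Set Implicit Arguments.
Unset Strict Implicit.
Unset Printing Implicit Defensive.

Import Order.TTheory GRing.Theory Num.Theory.
Local Open Scope ring_scope.

(** * Branches of a tree at a node *)

Definition adj_off (T : sgraph) (x : T) : rel T :=
  [rel u v | [&& u != x, v != x & adj u v]].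

(* The component of [z] in [T - x]; when [z = x] it is the junk value [set x]. *)
Definition branch (T : sgraph) (x z : T) : {set T} :=
  [set v | connect (adj_off x) z v].

Lemma connect_cross (T : finType) (e : rel T) (A : {set T}) (a b : T) :
  connect e a b -> a \notin A -> b \in A ->
  exists u v, [/\ e u v, u \notin A & v \in A].
Proof.
case/connectP=> p; elim: p a => [|c p IHp] a /=.
  by move=> _ -> /negP.
case/andP=> eac pth lst aA bA.
have [cA|cA] := boolP (c \in A); first by exists a, c.
exact: IHp pth lst cA bA.
Qed.

Section Branches.
Variable T : sgraph.
Implicit Types x y z u v : T.

Lemma connect_adj_off_sym x : connect_sym (adj_off x).
Proof.
apply: sym_connect_sym => u v.
by rewrite /adj_off /= andbCA adj_sym.
Qed.

Lemma branch_refl x z : z \in branch x z.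
Proof. by rewrite inE connect0. Qed.

Lemma adj_off_branch x z u v :
  adj_off x u v -> (u \in branch x z) = (v \in branch x z).
Proof.
move=> xuv; rewrite !inE.
by rewrite (same_connect_r (connect_adj_off_sym x) (connect1 xuv)).
Qed.

Lemma branch_notin x z : z != x -> x \notin branch x z.
Proof.
move=> zx; apply/negP; rewrite inE connect_adj_off_sym => /connectP[[|c p] /=].
  by move=> _ zE; rewrite zE eqxx in zx.
by rewrite {1}/adj_off /= eqxx.
Qed.

Lemma branch_eq x y z : y \in branch x z -> branch x y = branch x z.
Proof.
rewrite inE => zy; apply/setP=> v; rewrite !inE.
exact/esym/same_connect/zy/connect_adj_off_sym.
Qed.

Lemma connected_sub_branch (A : {set T}) x z :
  connected_on A -> x \notin A -> z \in A -> A \subset branch x z.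
Proof.
move=> conA xA zA; apply/subsetP=> v vA; rewrite inE.
apply: connect_sub (conA z v zA vA) => u w /= /andP[/andP[uA wA] uw].
apply: connect1; rewrite /adj_off /= uw andbT.
by apply/andP; split; [apply: contraNneq xA => <-|apply: contraNneq xA => <-].
Qed.

Hypothesis treeT : is_tree T.

Lemma branch_neighbour x z : z != x -> exists2 y, adj x y & y \in branch x z.
Proof.
move=> zx; have [_ conT _] := treeT.
have [u [v [/= uv uC vC]]] := connect_cross
  (conT x z (in_setT _) (in_setT _)) (branch_notin zx) (branch_refl x z).
have [ux|ux] := eqVneq u x; first by exists v; rewrite // -ux; case/andP: uv.
have vx : v != x by apply: contraTneq vC => ->; exact: branch_notin.
case/negP: uC; rewrite (@adj_off_branch x z u v) //.
by rewrite /adj_off /= ux vx; case/andP: uv.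
Qed.

(** A path from [y] to a different [y'] avoiding [x] would close up through [x] into a cycle of
    length at least 3. *)
Lemma branch_neighbour_uniq x y y' :
  adj x y -> adj x y' -> y' \in branch x y -> y' = y.
Proof.
move=> xy xy'; rewrite inE => /connectP[p0 p0P p0l].
case/shortenP: p0P p0l => p pP pU _ lstE.
have [_ _ acyc] := treeT.
apply/eqP/negP=> /negP y'y.
case: p pP pU lstE => [|c p] pP pU lstE; first by rewrite lstE eqxx in y'y.
suff /acyc : ucycle (@adj T) [:: x, y, c & p] by [].
apply/andP; split.
  rewrite (_ : cycle _ _ = path (@adj T) x (rcons (y :: c :: p) x)) //.
  rewrite rcons_path.
  have -> : last x (y :: c :: p) = y' by rewrite lstE.
  rewrite [adj y' x]adj_sym xy' andbT -cat1s cat_path /= xy /=.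
  by apply: sub_path pP => u v /and3P[].
rewrite cons_uniq pU andbT; apply/negP=> xp.
have : x \in branch x y by rewrite inE; apply: (path_connect pP).
apply/negP/branch_notin; apply: contraTneq xy => ->.
by rewrite adj_irrefl.
Qed.

(** As [y] is the only neighbour of [x] in its branch, every walk into or out of that branch uses
    the edge [xy], hence meets [y]. *)
Lemma connect_off_branch x y a b : adj x y ->
  connect (adj_off y) a b -> (a \in branch x y) = (b \in branch x y).
Proof.
move=> xy; wlog suff imp : a b / connect (adj_off y) a b ->
    b \in branch x y -> a \in branch x y.
  by move=> ab; apply/idP/idP; apply: imp; rewrite // connect_adj_off_sym.
move=> ab bC; apply/negPn/negP=> aC.
have [u [v [uv uC vC]]] := connect_cross ab aC bC.
have yx : y != x by apply: contraTneq xy => ->; rewrite adj_irrefl.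
case/and3P: uv => _ vy uv.
have [ux|ux] := eqVneq u x.
  case/eqP: vy; apply: branch_neighbour_uniq xy _ vC; by rewrite -ux.
have vx : v != x by apply: contraTneq vC => ->; exact: branch_notin.
by case/negP: uC; rewrite (@adj_off_branch x y u v) // /adj_off /= ux vx.
Qed.

Lemma branchC x y : adj x y -> branch y x = ~: branch x y.
Proof.
move=> xy.
have yx : y != x by apply: contraTneq xy => ->; rewrite adj_irrefl.
apply/setP=> v; rewrite !inE; apply/idP/idP=> [xv|].
  have := connect_off_branch xy xv; rewrite !inE => <-.
  by have := branch_notin yx; rewrite inE.
move=> vC; apply: contraT => xv.
have vy : v != y by apply: contraNneq vC => ->; exact: connect0.
have [w yw] := branch_neighbour vy; rewrite inE => vw.
have wx : w != x.
  by apply: contraNneq xv => wE; rewrite -wE connect_adj_off_sym.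
case/negP: vC; have := connect_off_branch xy vw; rewrite !inE => ->.
by apply: connect1; rewrite /adj_off /= yx wx yw.
Qed.

Lemma branch_proper x y z : adj x y -> z != y -> z \notin branch y x ->
  branch y z \proper branch x y.
Proof.
move=> xy zy; rewrite branchC // inE negbK => zC.
apply/properP; split.
  apply/subsetP=> v; rewrite [v \in branch y z]inE => zv.
  by rewrite -(connect_off_branch xy zv).
by exists y; [exact: branch_refl|exact: branch_notin].
Qed.

(** Extremal argument shared by [clique_sub_bag] and [balanced_node]: a branch at [y] away from [x]
    that satisfied [P] would be smaller, by [branch_proper]. *)
Lemma minimal_branch (P : {set T} -> Prop) x0 z0 : z0 != x0 ->
  P (branch x0 z0) -> exists x y, [/\ adj x y, P (branch x y),
    branch y x = ~: branch x y &
    forall z, z != y -> P (branch y z) -> z \in branch y x].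
Proof.
move=> zx0 P0.
pose Q (p : T * T) := (p.2 != p.1) && `[< P (branch p.1 p.2) >].
have Q0 : Q (x0, z0) by rewrite /Q /= zx0; apply/asboolP.
case: (arg_minnP (fun p : T * T => #|branch p.1 p.2|) Q0) => -[x z] /=.
case/andP=> /= zx /asboolP Pxz minxz.
have [y xy yC] := branch_neighbour zx.
rewrite -(branch_eq yC) in Pxz minxz.
exists x, y; split=> //; first exact: branchC.
move=> w wy Pw; apply: contraT => wC.
have := minxz (y, w); rewrite /Q /= wy => /(_ (asboolT Pw)).
by rewrite leqNgt (proper_card (branch_proper xy wy wC)).
Qed.

End Branches.

(** * Helly property of subtrees, and balanced nodes *)

Lemma clique_sub_bag (H : sgraph) (D : tree_dec H) (K : {set H}) :
  {in K &, forall u v, u != v -> adj u v} ->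
  exists t, K \subset td_bag (t : td_tree D).
Proof.
move=> cliqueK; have treeT := td_treeP D.
pose S (v : H) := [set t : td_tree D | v \in td_bag t].
apply: contrapT => noT.
(* Every node [x] points to the branch holding the whole subtree of a member of [K] missing from its
   bag; two adjacent nodes will point at each other. *)
have towards x : exists2 u, u \in K & exists2 z, z != x & S u \subset branch x z.
  have /subsetPn[u uK ux] : ~~ (K \subset td_bag x).
    by apply/negP=> Kx; apply: noT; exists x.
  exists u => //; have [z uz] := td_vertexP D u.
  have xS : x \notin S u by rewrite inE.
  have zS : z \in S u by rewrite inE.
  exists z; first by apply: contraNneq ux => <-.
  exact: (connected_sub_branch (@td_connP _ D u) xS zS).
have [T0 _ _] := treeT; have /card_gt0P[x0 _] := T0.
(* For a minimal branch satisfying [P], the two ends of its attaching edge would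
   have clique members with disjoint subtrees. *)
pose P (C : {set td_tree D}) := exists2 u, u \in K & S u \subset C.
have [u0 u0K [z0 zx0 u0C]] := towards x0.
have P0 : P (branch x0 z0) by exists u0.
have [x [y [xy [u uK uC] compl miny]]] := minimal_branch treeT zx0 P0.
have [v vK [z zy vC]] := towards y.
have zC := miny z zy (ex_intro2 _ _ v vK vC).
rewrite (branch_eq zC) compl in vC.
have [t ut vt] : exists2 t, t \in S u & t \in S v.
  have [<-|uv] := eqVneq u v.
    by have [t ut] := td_vertexP D u; exists t; rewrite inE.
  have [t /andP[ut vt]] := @td_edgeP _ D u v (cliqueK u v uK vK uv).
  by exists t; rewrite inE.
by have := subsetP vC t vt; rewrite inE (subsetP uC).
Qed.

(** Call a branch heavy if it receives more than [m] vertices. [U] is a minimal heavy branch and [y]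
    its attaching node; a heavy branch at [y] can only be the one leading out of [U]. If no branch
    is heavy, [U] is the whole tree and any [y] serves. *)
Lemma balanced_node (T : sgraph) (V : finType) (W : {set V}) (f : V -> T)
    (m : nat) : is_tree T -> (m < #|W|)%N ->
  exists y (U : {set T}), (m < #|W :&: f @^-1: U|)%N /\
    forall z, z \in U -> z != y ->
      branch y z \subset U /\ (#|W :&: f @^-1: branch y z| <= m)%N.
Proof.
move=> treeT mW.
pose P (C : {set T}) := (m < #|W :&: f @^-1: C|)%N.
have [[x0 [z0 zx0 P0]]|small] := pselect (exists x, exists2 z, z != x & P (branch x z)).
  have [x [y [xy Pxy compl miny]]] := minimal_branch treeT (P := P) zx0 P0.
  exists y, (branch x y); split=> // z zC zy.
  have zN : z \notin branch y x by rewrite compl inE negbK.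
  split; first exact: proper_sub (branch_proper treeT xy zy zN).
  by rewrite leqNgt; apply: contra zN; exact: miny.
have [/card_gt0P[y _] _ _] := treeT.
exists y, [set: T]; split=> [|z _ zy]; first by rewrite preimsetT setIT.
split; first exact: subsetT.
by rewrite leqNgt; apply/negP=> Pz; apply: small; exists y, z.
Qed.

(* The edges credited to a component of [c] vertices: at least [k * c] edges
   meet it, and at most ['C(c, 2)] of them lie inside it. *)
Definition gain (k : rat) (c : nat) : rat := k * c%:R - 'C(c, 2)%:R.

Lemma gainE k c : gain k c = k * c%:R - c%:R * (c%:R - 1) / 2.
Proof.
rewrite /gain; suff -> : 'C(c, 2)%:R = c%:R * (c%:R - 1) / 2 :> rat by [].
elim: c => [|c IHc]; first by rewrite bin0n /=; ring.
by rewrite binS bin1 natrD IHc -(natr1 c); field.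
Qed.

Lemma sum_gain (I : finType) (P : pred I) (c : I -> nat) (m : nat) (k : rat) :
  0 <= k -> k <= m%:R -> m%:R < k + 1 ->
  (forall i, P i -> (c i <= m)%N) -> (m < \sum_(i | P i) c i)%N ->
  k ^+ 2 / 2 + 3 / 2 * k <= \sum_(i | P i) gain k (c i).
Proof.
move=> k0 km mk cm sum_gt.
suff : gain k m + gain k 1 <= \sum_(i | P i) gain k (c i).
  (* With [m = k + d] and [0 <= d < 1], the two sides differ by [d * (1 - d) / 2]. *)
  by apply: le_trans; rewrite !gainE; nra.
(* Invariant of the induction: the gains summed so far are at least [h] of the sizes summed so
   far. *)
pose h s := if (s <= m)%N then gain k s else gain k m + gain k 1.
suff : h (\sum_(i | P i) c i)%N <= \sum_(i | P i) gain k (c i).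
  by rewrite /h leqNgt sum_gt.
elim/big_rec2: _ => [|i x y Pi hy]; first by rewrite /h /gain bin0n mulr0 subrr.
have ci := cm i Pi; apply: (@le_trans _ _ (gain k (c i) + h y)); last first.
  by rewrite lerD2l.
(* Once the total exceeds [m], it suffices that [gain k (c i)] is nonnegative, which holds as
   [c i <= m < k + 1]. *)
rewrite /h; have [ym|ym] := leqP y m; last first.
  rewrite leqNgt ltn_addl //= lerDr gainE.
  have cmR : (c i)%:R <= m%:R :> rat by rewrite ler_nat.
  have c0 : 0 <= (c i)%:R :> rat by [].
  by nra.
have [cym|cym] := leqP (c i + y) m.
  rewrite !gainE natrD.
  have c0 : 0 <= (c i)%:R * y%:R :> rat by rewrite -natrM.
  by nra.
(* The sum passes [m] here. In these variables [gain k (c i) + gain k y] exceeds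
   [gain k m + gain k 1] by [t * (k + 1 - m) + t * (t - 1) / 2 + t * p + t * q + p * q]. *)
have [t [p [q [mE cE yE]]]] : exists t p q,
    [/\ m = (t + p + q).+1, c i = (t + q).+1 & y = (t + p).+1].
  by exists (c i + y - m.+1)%N, (m - c i)%N, (m - y)%N; split; lia.
have tt : 0 <= t%:R * (t%:R - 1) :> rat.
  by case: (t) => [|u]; rewrite ?mul0r // -natr1 addrK mulr_ge0 ?addr_ge0.
have tp : 0 <= t%:R * p%:R :> rat by rewrite -natrM.
have tq : 0 <= t%:R * q%:R :> rat by rewrite -natrM.
have pq : 0 <= p%:R * q%:R :> rat by rewrite -natrM.
have te : 0 <= t%:R * (k + 1 - m%:R) :> rat.
  by apply: mulr_ge0; rewrite // subr_ge0 ltW.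
rewrite cE yE !gainE; move: te.
by rewrite mE -(natr1 (t + p + q)) -(natr1 (t + q)) -(natr1 (t + p)) !natrD; nra.
Qed.

(** * Counting the edges of [G] in one bag *)

Section Counting.
Variable G : sgraph.

Lemma card_edge (e : {set G}) : e \in edges G -> #|e| = 2.
Proof.
case/imsetP=> -[a b]; rewrite inE /= => ab ->; rewrite cards2.
by case: eqVneq ab => // ->; rewrite adj_irrefl.
Qed.

(** Deleting [S] from a maximiser of [F] cannot raise [F], so it destroys at least [k * #|S|]
    edges. *)
Lemma dense_subset (k : rat) : (0 < #|G|)%N -> k * #|G|%:R <= #|edges G|%:R ->
  exists2 W : {set G}, W != set0 & forall S : {set G}, S \subset W ->
    k * #|S|%:R <=
      #|[set e in edges G | (e \subset W) && ~~ (e \subset W :\: S)]|%:R.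
Proof.
move=> G0 kG.
pose ein (W : {set G}) := [set e in edges G | e \subset W].
pose F (W : {set G}) : rat := #|ein W|%:R - k * #|W|%:R.
have T0 : [set: G] != set0 by rewrite -card_gt0 cardsT.
case: (arg_maxP (P := fun W : {set G} => W != set0) F T0) => W W0 maxW; exists W => // S SW.
have FW_ge0 : 0 <= F W.
  apply: le_trans (maxW _ T0); rewrite /F subr_ge0 cardsT.
  suff -> : ein [set: G] = edges G by [].
  by apply/setP=> e; rewrite inE subsetT andbT.
have le_FD : F (W :\: S) <= F W.
  (* The empty set is outside the range of the maximum, but its weight 0 is at most [F W]. *)
  have [->|D0] := eqVneq (W :\: S) set0; last exact: maxW.
  suff E0 : ein set0 = set0 by rewrite /F E0 !cards0 mulr0 subrr.
  apply/setP=> e; rewrite !inE subset0; apply/negP=> /andP[/card_edge e2 /eqP e0].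
  by rewrite e0 cards0 in e2.
have cS : #|W|%:R = #|S|%:R + #|W :\: S|%:R :> rat.
  by rewrite -natrD -(cardsID S W) (setIidPr SW).
have cE : #|ein W|%:R = #|ein (W :\: S)|%:R
   + #|[set e in edges G | (e \subset W) && ~~ (e \subset W :\: S)]|%:R :> rat.
  rewrite -natrD -(cardsID (ein (W :\: S)) (ein W)).
  have /setIidPr-> : ein (W :\: S) \subset ein W.
    apply/subsetP=> e; rewrite !inE => /andP[-> eW].
    exact: subset_trans eW (subsetDl _ _).
  suff -> : ein W :\: ein (W :\: S) =
      [set e in edges G | (e \subset W) && ~~ (e \subset W :\: S)] by [].
  by apply/setP=> e; rewrite !inE; case: (e \in edges G); rewrite ?andbF // andbC.
by move: le_FD; rewrite /F cE cS; lra.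
Qed.

Lemma placement (D : tree_dec (line_graph G)) :
  exists f : G -> td_tree D, forall (v : G) (e : line_graph G),
    v \in val e -> e \in td_bag (f v).
Proof.
have K v : exists t : td_tree D, [set e : line_graph G | v \in val e] \subset td_bag t.
  apply: clique_sub_bag => e1 e2; rewrite !inE => v1 v2 ne.
  by apply/andP; split=> //; apply/set0Pn; exists v; rewrite inE v1.
have [f fP] := choice K; exists f => v e ve.
by apply: (subsetP (fP v)); rewrite inE.
Qed.

(** Used for an edge missing from the bag of [t]: its two ends are placed in the same branch at
    [t]. *)
Lemma bag_connect (D : tree_dec (line_graph G)) (e : line_graph G) x y t :
  e \in td_bag x -> e \in td_bag y -> e \notin td_bag (t : td_tree D) ->
  (x != t) && connect (adj_off t) x y.
Proof.
move=> ex ey et; apply/andP; split; first by apply: contraNneq et => <-.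
have tA : t \notin [set t | e \in td_bag t] by rewrite inE.
have xA : x \in [set t | e \in td_bag t] by rewrite inE.
have := subsetP (connected_sub_branch (@td_connP _ D e) tA xA) y.
by rewrite !inE; apply.
Qed.

Lemma card_bigcup_draws (P : {set {set G}}) :
  (#|\bigcup_(A in P) [set e : {set G} | e \subset A & #|e| == 2]| <=
   \sum_(A in P) 'C(#|A|, 2))%N.
Proof.
elim/big_rec2: _ => [|A n U _ IH]; first by rewrite cards0.
apply: leq_trans (leq_card_setU _ _) _.
by rewrite cards_draws leq_add2l.
Qed.

Lemma large_bag (k : rat) (m : nat) (D : tree_dec (line_graph G)) :
  (0 < #|G|)%N -> k * #|G|%:R <= #|edges G|%:R ->
  0 < k -> k <= m%:R -> m%:R < k + 1 ->
  exists t : td_tree D, k ^+ 2 / 2 + 3 / 2 * k <= #|td_bag t|%:R.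
Proof.
move=> G0 kG k0 km mk; have [W W0 dW] := dense_subset G0 kG.
have m0 : (0 < m)%N by rewrite -(ltr_nat rat) (lt_le_trans k0 km).
(* Taking [S = W] gives [k * #|W| <= 'C(#|W|, 2)], so [#|W| >= 2 * k + 1 > m]. *)
have mW : (m < #|W|)%N.
  have le2 : k * #|W|%:R <= 'C(#|W|, 2)%:R.
    apply: le_trans (dW W (subxx W)) _; rewrite ler_nat -cards_draws.
    apply/subset_leq_card/subsetP=> e; rewrite !inE => /and3P[eE -> _].
    by rewrite card_edge.
  have Wp : 0 < #|W|%:R :> rat by rewrite ltr0n card_gt0.
  have : 0 <= - gain k #|W| by rewrite /gain oppr_ge0 subr_le0.
  rewrite gainE => gW.
  have : 0 <= (#|W|%:R - 1) / 2 - k.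
    by rewrite -(pmulr_rge0 _ Wp); move: gW; lra.
  have [Wm|//] := leqP #|W| m.
  by move: Wm; rewrite -(ler_nat rat); lra.
have [f fP] := placement D.
have [y [U [mU Ubr]]] := balanced_node f (td_treeP D) mW.
exists y; set S := W :&: f @^-1: U in mU.
(* The clause [f v != y] makes each vertex placed at [y] a class of its own; [connect] alone would
   merge them all. *)
pose same v w := (v == w) || ((f v != y) && connect (adj_off y) (f v) (f w)).
pose P := equivalence_partition same S.
have same_eq : {in S & &, equivalence_rel same}.
  have sym u v : same u v -> same v u.
    case/orP=> [/eqP->|/andP[uy uv]]; first by rewrite /same eqxx.
    apply/orP; right; rewrite connect_adj_off_sym uv andbT.
    by apply: contraTneq uv => ->; have := branch_notin uy; rewrite inE.
  have trans u v w : same u v -> same v w -> same u w.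
    case/orP=> [/eqP-> //|/andP[uy uv]] /orP[/eqP<-|/andP[_ vw]].
      by rewrite /same uy uv orbT.
    by rewrite /same uy (connect_trans uv vw) orbT.
  move=> u v w _ _ _; split=> [|uv]; first by rewrite /same eqxx.
  by apply/idP/idP; apply: trans => //; exact: sym.
have PS : partition P S := equivalence_partitionP same_eq.
have Psmall A : A \in P -> (#|A| <= m)%N.
  case/imsetP=> v; rewrite !inE => /andP[vW vU] ->.
  have [vy|vy] := eqVneq (f v) y.
    apply: leq_trans m0; rewrite -(cards1 v).
    apply/subset_leq_card/subsetP=> w.
    by rewrite !inE /same vy eqxx /= orbF eq_sym => /andP[].
  have [_ small] := Ubr (f v) vU vy; apply: leq_trans small.
  apply/subset_leq_card/subsetP=> w; rewrite !inE => /andP[/andP[-> _]] /=.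
  by case/orP=> [/eqP->|/andP[]] //; exact: connect0.
pose B : {set {set G}} := val @: td_bag y.
have cB : #|B| = #|td_bag y| by rewrite card_imset //; exact: val_inj.
(* An edge meeting [S] but absent from the bag of [y] stays in one branch at [y], which lies in [U];
   so it lies inside one class. *)
have cover : [set e in edges G | (e \subset W) && ~~ (e \subset W :\: S)] \subset
  B :|: \bigcup_(A in P) [set e : {set G} | e \subset A & #|e| == 2].
  apply/subsetP=> e; rewrite !inE => /and3P[eE eW /subsetPn[a ae]].
  rewrite !inE negb_and negbK (subsetP eW a ae) orbF /= => aU.
  pose e' : line_graph G := Sub e eE.
  have [ey|ey] := boolP (e' \in td_bag y).
    by apply/orP; left; apply/imsetP; exists e'.
  apply/orP; right; apply/bigcupP; exists [set w in S | same a w].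
    by apply/imset_f; rewrite !inE (subsetP eW a ae).
  rewrite inE card_edge // eqxx andbT; apply/subsetP=> b be.
  have /andP[ay ab] := bag_connect (fP a e' ae) (fP b e' be) ey.
  have [sub _] := Ubr (f a) aU ay.
  rewrite !inE (subsetP eW b be) /same ay ab orbT andbT /=.
  by apply: (subsetP sub); rewrite inE.
have := dW S (subsetIl _ _).
have := subset_leq_card cover => /leq_trans/(_ (leq_card_setU _ _)).
rewrite cB => /leq_trans/(_ (leq_add (leqnn _) (card_bigcup_draws P))).
rewrite -(ler_nat rat) natrD => /[swap] /le_trans /[apply].
rewrite (card_partition PS) !natr_sum mulr_sumr -lerBlDr -sumrB.
apply: le_trans; apply: (sum_gain (ltW k0) km mk Psmall).
by rewrite -(card_partition PS).
Qed.

End Counting.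

Theorem theorem1p1 (G : sgraph) (hG : (0 < #|G|)%N) :
  pathwidth (line_graph G) >= treewidth (line_graph G) /\
  (treewidth (line_graph G))%:~R >
    1 / 8 * avg_degree G ^+ 2 + 3 / 4 * avg_degree G - 2.
Proof.
have [[D wD] minD] := treewidthP (line_graph G).
split; first by have [[D' _ <-] _] := pathwidthP (line_graph G); exact: minD.
have n0 : 0 < #|G|%:R :> rat by rewrite ltr0n.
have [k kE] : exists k, k = #|edges G|%:R / #|G|%:R :> rat by eexists.
have -> : avg_degree G = 2 * k by rewrite kE /avg_degree mulrA.
have k_ge0 : 0 <= k by rewrite kE divr_ge0.
rewrite -wD /width intrB.
(* Strictness comes from the constants: the width is the bag size minus 1, the target subtracts
   2. *)
suff [b [bD lek]] : exists b : nat, (b <= max_bag D)%N /\ k ^+ 2 / 2 + 3 / 2 * k <= b%:R.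
  have : b%:R <= (max_bag D)%:R :> rat by rewrite ler_nat.
  rewrite -pmulrn; nra.
(* An edgeless graph is treated apart, because [large_bag] asks for [0 < k]. *)
have [k0|k_neq0] := eqVneq k 0.
  by exists 0; split=> //; rewrite k0; lra.
have kex : exists m : nat, k <= m%:R.
  by exists (Num.bound k); apply/ltW/archi_boundP.
have [m km minm] := ex_minnP kex.
have mk : m%:R < k + 1.
  case: m km minm => [_ _|m _ minm]; first by rewrite ltr_wpDl.
  rewrite -natr1 ltrD2r ltNge; apply/negP=> /minm.
  by rewrite ltnn.
have [||t ht] := @large_bag G k m D hG _ _ km mk.
- by rewrite kE divfK // gt_eqF.
- by rewrite lt_def k_neq0.
by exists #|td_bag t|; split=> //; exact: leq_bigmax.
Qed.
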